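(* Let $n\ge0$ be an integer with $\chi_n>c^2$, and let $x\in(1,\infty)$ be a root of $\psi_n$. Then $$\frac{1}{|\psi_n'(x)|}\le e^{1/4}|\lambda_n|\frac{(x^2-1)^{3/4}}{(x^2-\chi_n/c^2)^{1/4}}.$$
   Context: For a real number $c>0$, let $F_c[\varphi](x)=\int_{-1}^1\varphi(t)e^{icxt}\,dt$ on $L^2[-1,1]$, with eigenvalues $\lambda_0,\lambda_1,\dots$ ordered so that $|\lambda_n|\ge|\lambda_{n+1}|$ (nonzero, simple) and corresponding real eigenfunctions $\psi_0,\psi_1,\dots$ (prolate spheroidal wave functions) with $\|\psi_n\|_{L^2[-1,1]}=1$. Each $\psi_n$ is extended to an entire function by $\lambda_n\psi_n(x)=\int_{-1}^1\psi_n(t)e^{icxt}\,dt$ for all complex $x$. $\chi_0<\chi_1<\dots$ are the positive numbers such that $\psi_n$ satisfies $(1-x^2)\psi''(x)-2x\psi'(x)+(\chi_n-c^2x^2)\psi(x)=0$ (which then holds for all complex $x$). *)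

(* Defs.v *)
From Stdlib Require Import Reals.
From Coquelicot Require Import Coquelicot.
Open Scope R_scope.

(* The eigen-equation  lam * psi(x) = \int_{-1}^1 psi(t) e^{i c x t} dt  for a
   real-valued psi and a complex lam, written out in real and imaginary parts
   (e^{icxt} = cos(cxt) + i sin(cxt)).  It is required for every real x: this
   is the definition of the (entire) extension of psi, restricted to R. *)
Definition Fc_eigen (c : R) (lam : C) (psi : R -> R) : Prop :=
  forall x : R,
    ex_RInt (fun t => psi t * cos (c * x * t)) (-1) 1 /\
    ex_RInt (fun t => psi t * sin (c * x * t)) (-1) 1 /\
    Re lam * psi x = RInt (fun t => psi t * cos (c * x * t)) (-1) 1 /\
    Im lam * psi x = RInt (fun t => psi t * sin (c * x * t)) (-1) 1.

Definition prolate_ode (c chi : R) (psi : R -> R) : Prop :=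
  forall x : R,
    ex_derive psi x /\ ex_derive (Derive psi) x /\
    (1 - x ^ 2) * Derive (Derive psi) x - 2 * x * Derive psi x
      + (chi - c ^ 2 * x ^ 2) * psi x = 0.

Definition pswf_family (c : R) (lam : nat -> C) (psi : nat -> R -> R)
  (chi : nat -> R) : Prop :=
  (forall n, lam n <> 0%C) /\
  (forall n, Cmod (lam (S n)) <= Cmod (lam n)) /\
  (forall n, Fc_eigen c (lam n) (psi n)) /\
  (forall n, ex_RInt (fun t => psi n t ^ 2) (-1) 1 /\
             RInt (fun t => psi n t ^ 2) (-1) 1 = 1) /\
  (forall n, 0 < chi n) /\
  (forall n, chi n < chi (S n)) /\
  (forall n, prolate_ode c (chi n) (psi n)).

(* Main.v *)
Require Import Defs.
From Stdlib Require Import Reals Lra.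
From Coquelicot Require Import Coquelicot.
Open Scope R_scope.

(** Beyond the turning point [x^2 = b := chi/c^2], the Liouville transform
    turns the prolate equation into [u'' + (1 + V) u = 0] with [V] nonnegative
    and decreasing, so the energy [u'^2 + (1 + V) u^2] is nonincreasing.  At a
    root of [psi] the energy is a multiple of [psi'^2]; at any later point [X]
    it is at least [u^2].  Two integrations by parts in the eigen-equation give
    [|lam psi(X)| = 2 |psi 1| |sin (c X + p)| / (c X) + O(X^-2)], and
    [psi(1)^2 >= 1/2] because [chi > c^2] forces [|psi|] to be maximal on
    [[-1, 1]] at the end points.  Letting [X] grow along the points where the
    sine is [1] bounds [psi'] from below at the root.  Roots lie beyond the
    turning point since [psi^2] is nondecreasing between [1] and [sqrt b]. *)

(** * Monotonicity from derivatives, and smoothness of cosine transforms *)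

Lemma nondecreasing_of_derive_nonneg (f df : R -> R) (a b : R) :
  a <= b ->
  (forall t, a <= t <= b -> is_derive f t (df t)) ->
  (forall t, a <= t <= b -> 0 <= df t) ->
  f a <= f b.
Proof.
  intros Hab Hd Hnn.
  destruct (MVT_gen f a b df) as [t [Ht Heq]];
    rewrite ?Rmin_left, ?Rmax_right in * by lra.
  - intros t Ht; apply Hd; lra.
  - intros t Ht. apply continuity_pt_filterlim.
    apply (ex_derive_continuous f). exists (df t). now apply Hd.
  - specialize (Hnn t Ht). nra.
Qed.

Lemma ex_RInt_of_continuous (f : R -> R) (a b : R) :
  (forall t, continuous f t) -> ex_RInt f a b.
Proof. intros H. apply (ex_RInt_continuous (V := R_CompleteNormedModule)). auto. Qed.

Lemma continuous_mult_cos_phase (g : R -> R) (w p t : R) :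
  continuous g t -> continuous (fun t => g t * cos (w * t + p)) t.
Proof.
  intros Hg. apply (continuous_mult g); [exact Hg|].
  apply (ex_derive_continuous (fun t => cos (w * t + p))). now auto_derive.
Qed.

(** The free phase [p] covers the cosine kernel ([p = 0]) and the sine kernel ([p = - PI / 2]) at
    once, and keeps the class of transforms closed under differentiation. *)
Definition cos_transform (c p : R) (g : R -> R) (x : R) : R :=
  RInt (fun t => g t * cos (c * x * t + p)) (-1) 1.

(** Differentiation under the integral sign; a derivative of the cosine is a phase shift by
    [PI / 2], so the rule can be iterated. *)
Lemma is_derive_cos_transform (c p : R) (g : R -> R) (x : R) :
  (forall t, continuous g t) ->
  is_derive (cos_transform c p g) x
    (cos_transform c (p + PI / 2) (fun t => c * t * g t) x).
Proof.
  intros Hg.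
  assert (HD : forall u t, is_derive (fun z => g t * cos (c * z * t + p)) u
             (c * t * g t * cos (c * u * t + (p + PI / 2)))).
  { intros u t. auto_derive; [easy|].
    replace (c * u * t + (p + PI / 2)) with (PI / 2 + (c * u * t + p)) by ring.
    replace (cos (PI / 2 + (c * u * t + p))) with (- sin (c * u * t + p))
      by (rewrite (sin_cos (c * u * t + p)); ring).
    ring. }
  unfold cos_transform.
  rewrite (RInt_ext _ (fun t => Derive (fun z => g t * cos (c * z * t + p)) x)).
  2: { intros t _. symmetry. apply is_derive_unique, HD. }
  apply (is_derive_RInt_param (fun z t => g t * cos (c * z * t + p))).
  - apply filter_forall. intros u t _. eexists. apply HD.
  - intros t _.
    apply (continuity_2d_pt_ext
             (fun u v => c * v * g v * cos (c * u * v + (p + PI / 2)))).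
    { intros u v. symmetry. apply is_derive_unique, HD. }
    apply continuity_2d_pt_mult.
    + apply continuity_2d_pt_mult.
      * apply continuity_2d_pt_mult;
          [apply continuity_2d_pt_const | apply continuity_2d_pt_id2].
      * apply (continuity_1d_2d_pt_comp g (fun _ v => v)).
        -- apply continuity_pt_filterlim, Hg.
        -- apply continuity_2d_pt_id2.
    + apply (continuity_1d_2d_pt_comp cos).
      * apply continuity_cos.
      * apply continuity_2d_pt_plus; [|apply continuity_2d_pt_const].
        apply continuity_2d_pt_mult; [|apply continuity_2d_pt_id2].
        apply continuity_2d_pt_mult;
          [apply continuity_2d_pt_const | apply continuity_2d_pt_id1].
  - apply filter_forall. intros u. apply ex_RInt_of_continuous.
    intros t. now apply continuous_mult_cos_phase.
Qed.

Lemma continuous_scaled_id_mult (c : R) (g : R -> R) (t : R) :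
  continuous g t -> continuous (fun t => c * t * g t) t.
Proof.
  intros Hg. apply (continuous_mult (fun t => c * t) g); [|exact Hg].
  apply (ex_derive_continuous (fun t => c * t)). now auto_derive.
Qed.

(** The differential equation degenerates at the points 1 and -1, so it does not yield continuity of
    [psi''] there. The integral representation does: differentiated twice, it is again a transform
    of a continuous function, hence differentiable. *)
Lemma continuous_Derive2_eigenfunction (c m p : R) (g : R -> R) :
  m <> 0 -> (forall t, continuous g t) ->
  (forall x, m * g x = cos_transform c p g x) ->
  forall x, continuous (Derive (Derive g)) x.
Proof.
  intros Hm Hg Heig x.
  set (g1 := fun t => c * t * g t).
  set (g2 := fun t => c * t * g1 t).
  assert (Hg1 : forall t, continuous g1 t)
    by (intros t; now apply continuous_scaled_id_mult).
  assert (Hg2 : forall t, continuous g2 t)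
    by (intros t; now apply continuous_scaled_id_mult).
  assert (D1 : forall u, Derive g u = / m * cos_transform c (p + PI / 2) g1 u).
  { intros u. apply is_derive_unique.
    apply (is_derive_ext (fun z => / m * cos_transform c p g z)).
    - intros z. change (/ m * cos_transform c p g z = g z).
      rewrite <- Heig. now field.
    - apply (is_derive_scal (cos_transform c p g)).
      now apply is_derive_cos_transform. }
  assert (D2 : forall u, Derive (Derive g) u
               = / m * cos_transform c (p + PI / 2 + PI / 2) g2 u).
  { intros u. apply is_derive_unique.
    apply (is_derive_ext (fun z => / m * cos_transform c (p + PI / 2) g1 z)).
    - intros z. now rewrite D1.
    - apply (is_derive_scal (cos_transform c (p + PI / 2) g1)).
      now apply is_derive_cos_transform. }
  apply (continuous_ext (fun u => / m * cos_transform c (p + PI / 2 + PI / 2) g2 u)).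
  - intros u. now rewrite D2.
  - apply (ex_derive_continuous
             (fun u => / m * cos_transform c (p + PI / 2 + PI / 2) g2 u)).
    eexists. apply (is_derive_scal (cos_transform c (p + PI / 2 + PI / 2) g2)).
    now apply is_derive_cos_transform.
Qed.

(** * Asymptotics of an oscillatory integral *)

Lemma continuous_bounded_segment (f : R -> R) (a b : R) :
  a <= b -> (forall t, continuous f t) ->
  exists M, forall t, a <= t <= b -> Rabs (f t) <= M.
Proof.
  intros Hab Hf.
  destruct (continuity_ab_maj (fun t => Rabs (f t)) a b Hab) as [u [Hu _]].
  - intros t _. apply continuity_pt_filterlim.
    apply (continuous_comp f Rabs); [apply Hf | apply continuous_Rabs].
  - now exists (Rabs (f u)).
Qed.

Lemma cos_integral_asymptotics (g : R -> R) (p : R) :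
  (forall t, ex_derive g t) -> (forall t, ex_derive (Derive g) t) ->
  (forall t, continuous (Derive (Derive g)) t) ->
  exists K, forall w, 0 < w ->
    Rabs (RInt (fun t => g t * cos (w * t + p)) (-1) 1
          - (g 1 * sin (w + p) - g (-1) * sin (- w + p)) / w) <= K / w ^ 2.
Proof.
  intros H1 H2 H3.
  destruct (continuous_bounded_segment (Derive (Derive g)) (-1) 1) as [M HM];
    [lra | exact H3 |].
  exists (Rabs (Derive g 1) + Rabs (Derive g (-1)) + 2 * M).
  intros w Hw.
  assert (Hc1 : forall t, continuous g t)
    by (intros t; now apply (ex_derive_continuous g)).
  (* Both integrations by parts in one antiderivative: in [F'] the terms with [Derive g] and a sine
     cancel, leaving the integrand plus the remainder [f2] of order [w^-2]. *)
  pose (F := fun t => g t * sin (w * t + p) / w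
                      + Derive g t * cos (w * t + p) / w ^ 2).
  pose (f2 := fun t => / w ^ 2 * (Derive (Derive g) t * cos (w * t + p))).
  assert (Hf2 : forall t, continuous f2 t).
  { intros t. apply (continuous_scal_r (/ w ^ 2)
      (fun t => Derive (Derive g) t * cos (w * t + p))).
    now apply continuous_mult_cos_phase. }
  assert (HF : is_RInt (fun t => g t * cos (w * t + p) + f2 t) (-1) 1
                 (F 1 - F (-1))).
  { apply (is_RInt_derive F).
    - intros t _. unfold F, f2.
      auto_derive; [repeat split; auto|].
      change (fun x => g x) with g. change (fun x => Derive g x) with (Derive g).
      field. lra.
    - intros t _. apply (continuous_plus (fun t => g t * cos (w * t + p)) f2).
      + now apply continuous_mult_cos_phase.
      + apply Hf2. }
  apply (is_RInt_unique (V := R_CompleteNormedModule)) in HF.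
  rewrite (RInt_plus (fun t => g t * cos (w * t + p)) f2) in HF.
  2: { apply ex_RInt_of_continuous. intros t. now apply continuous_mult_cos_phase. }
  2: { now apply ex_RInt_of_continuous. }
  unfold plus in HF; simpl in HF.
  assert (Hw2 : 0 < / w ^ 2) by (apply Rinv_0_lt_compat; nra).
  assert (HB : Rabs (RInt f2 (-1) 1) <= (1 - -1) * (/ w ^ 2 * M)).
  { apply abs_RInt_le_const; [lra | now apply ex_RInt_of_continuous |].
    intros t Ht. unfold f2. rewrite Rabs_mult, (Rabs_pos_eq (/ w ^ 2)) by lra.
    apply Rmult_le_compat_l; [lra|]. rewrite Rabs_mult.
    specialize (HM t Ht). pose proof (Rabs_pos (Derive (Derive g) t)).
    assert (Rabs (cos (w * t + p)) <= 1)
      by (apply Rabs_le; destruct (COS_bound (w * t + p)); lra).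
    pose proof (Rabs_pos (cos (w * t + p))). nra. }
  replace (RInt (fun t => g t * cos (w * t + p)) (-1) 1)
    with (F 1 - F (-1) - RInt f2 (-1) 1)
    by (rewrite <- HF; ring).
  unfold F.
  replace (w * 1) with w by ring. replace (w * -1) with (- w) by ring.
  set (I2 := RInt f2 (-1) 1) in *.
  replace (_ - _ - I2 - _)
    with (/ w ^ 2 * (Derive g 1 * cos (w + p))
          - / w ^ 2 * (Derive g (-1) * cos (- w + p)) - I2) by (field; lra).
  assert (Hcos : forall d z, Rabs (/ w ^ 2 * (d * cos z)) <= / w ^ 2 * Rabs d).
  { intros d z. rewrite Rabs_mult, (Rabs_pos_eq (/ w ^ 2)) by lra.
    apply Rmult_le_compat_l; [lra|]. rewrite Rabs_mult.
    assert (Rabs (cos z) <= 1)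
      by (apply Rabs_le; destruct (COS_bound z); lra).
    pose proof (Rabs_pos d). pose proof (Rabs_pos (cos z)). nra. }
  pose proof (Hcos (Derive g 1) (w + p)).
  pose proof (Hcos (Derive g (-1)) (- w + p)).
  unfold Rdiv.
  set (a1 := / w ^ 2 * (Derive g 1 * cos (w + p))) in *.
  set (a2 := / w ^ 2 * (Derive g (-1) * cos (- w + p))) in *.
  pose proof (Rabs_triang (a1 - a2) (- I2)).
  pose proof (Rabs_triang a1 (- a2)).
  rewrite Rabs_Ropp in *.
  replace (a1 - a2 - I2) with (a1 - a2 + - I2) by ring.
  replace (a1 + - a2) with (a1 - a2) in * by ring.
  lra.
Qed.

(** * The eigenfunction on [-1, 1] and up to the turning point *)

(** This is the Sonin function [psi^2 + P psi'^2 / q] of the self-adjoint form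
    [(P psi')' + q psi = 0], with [P = 1 - t^2] and [q = chi - c^2 t^2]. Its derivative is
    [- (P q)' psi'^2 / q^2], free of [psi'']. *)
Lemma prolate_energy_is_derive (c chi : R) (psi : R -> R) (t : R) :
  prolate_ode c chi psi -> chi - c ^ 2 * t ^ 2 <> 0 ->
  is_derive (fun t => psi t ^ 2 + (1 - t ^ 2) * Derive psi t ^ 2 / (chi - c ^ 2 * t ^ 2)) t
    (2 * t * (Derive psi t ^ 2 * / (chi - c ^ 2 * t ^ 2)
      * (1 + c ^ 2 * (1 - t ^ 2) / (chi - c ^ 2 * t ^ 2)))).
Proof.
  intros Hode Hq. destruct (Hode t) as [H1 [H2 H3]].
  auto_derive; [repeat split; auto|].
  change (fun x => psi x) with psi. change (fun x => Derive psi x) with (Derive psi).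
  set (a := psi t) in *. set (b := Derive psi t) in *.
  set (d := Derive (Derive psi) t) in *.
  (* The computed and the claimed derivatives differ by [2 psi' / q] times the left side of the
     differential equation. *)
  apply Rminus_diag_uniq.
  transitivity (2 * b / (chi - c ^ 2 * t ^ 2)
     * ((1 - t ^ 2) * d - 2 * t * b + (chi - c ^ 2 * t ^ 2) * a)).
  - field. intros K. apply Hq. rewrite <- K. ring.
  - rewrite H3. ring.
Qed.

(** The Sonin function dominates [psi^2] on the interval, grows with the distance from 0 on either
    side, and equals [psi^2] at the end points, where its second term vanishes. *)
Lemma prolate_endpoint_max (c chi : R) (psi : R -> R) (t : R) :
  prolate_ode c chi psi -> c ^ 2 < chi -> psi (-1) ^ 2 = psi 1 ^ 2 ->
  -1 <= t <= 1 -> psi t ^ 2 <= psi 1 ^ 2.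
Proof.
  intros Hode Hchi Hpar Ht.
  pose (E := fun t => psi t ^ 2 + (1 - t ^ 2) * Derive psi t ^ 2 / (chi - c ^ 2 * t ^ 2)).
  assert (Hq : forall u, -1 <= u <= 1 -> 0 < chi - c ^ 2 * u ^ 2).
  { intros u Hu. assert (0 <= c ^ 2) by nra. assert (u ^ 2 <= 1) by nra. nra. }
  assert (Hfac : forall u, -1 <= u <= 1 ->
     0 <= Derive psi u ^ 2 * / (chi - c ^ 2 * u ^ 2)
      * (1 + c ^ 2 * (1 - u ^ 2) / (chi - c ^ 2 * u ^ 2))).
  { intros u Hu. pose proof (Hq u Hu) as Hqu.
    apply Rinv_0_lt_compat in Hqu.
    assert (0 <= c ^ 2 * (1 - u ^ 2)) by (apply Rmult_le_pos; nra).
    unfold Rdiv.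
    apply Rmult_le_pos; [apply Rmult_le_pos; nra |]. nra. }
  assert (HE1 : psi t ^ 2 <= E t).
  { unfold E. pose proof (Hq t Ht) as Hqt. apply Rinv_0_lt_compat in Hqt.
    enough (0 <= (1 - t ^ 2) * Derive psi t ^ 2 / (chi - c ^ 2 * t ^ 2)) by lra.
    apply Rmult_le_pos; [apply Rmult_le_pos; nra | lra]. }
  assert (HEe : E 1 = psi 1 ^ 2 /\ E (-1) = psi 1 ^ 2).
  { unfold E. rewrite Hpar.
    replace (1 - 1 ^ 2) with 0 by ring. replace (1 - (-1) ^ 2) with 0 by ring.
    unfold Rdiv. split; ring. }
  destruct HEe as [HE2 HE3].
  destruct (Rle_dec 0 t) as [H0|H0].
  - enough (E t <= E 1) by lra.
    eapply nondecreasing_of_derive_nonneg; [lra | |].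
    + intros u Hu. apply (prolate_energy_is_derive c chi psi u Hode).
      assert (0 < chi - c ^ 2 * u ^ 2) by (apply Hq; lra). lra.
    + intros u Hu. cbv beta.
      apply Rmult_le_pos; [lra | apply Hfac; lra].
  - enough (- E (-1) <= - E t) by lra.
    apply (nondecreasing_of_derive_nonneg (fun u => - E u)
      (fun u => - (2 * u * (Derive psi u ^ 2 * / (chi - c ^ 2 * u ^ 2)
      * (1 + c ^ 2 * (1 - u ^ 2) / (chi - c ^ 2 * u ^ 2)))))); [lra | |].
    + intros u Hu. apply (is_derive_opp E). apply (prolate_energy_is_derive c chi psi u Hode).
      assert (0 < chi - c ^ 2 * u ^ 2) by (apply Hq; lra). lra.
    + intros u Hu. cbv beta. rewrite Ropp_mult_distr_l.
      apply Rmult_le_pos; [lra | apply Hfac; lra].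
Qed.

(** The product [(u^2 - 1) psi psi'] vanishes at 1, and the equation makes its derivative a sum of
    two terms that are nonnegative up to the turning point. Hence [psi psi' >= 0] there, and [psi^2]
    stays above [psi(1)^2 > 0]. *)
Lemma prolate_no_root_before_turning_point (c chi : R) (psi : R -> R) (x : R) :
  prolate_ode c chi psi -> psi 1 <> 0 -> 1 <= x -> c ^ 2 * x ^ 2 <= chi -> psi x <> 0.
Proof.
  intros Hode H1 Hx Hchi.
  assert (Hq : forall u, 1 <= u <= x -> 0 <= chi - c ^ 2 * u ^ 2).
  { intros u Hu. assert (0 <= c ^ 2) by nra. assert (u ^ 2 <= x ^ 2) by nra. nra. }
  assert (HH : forall u, 1 <= u <= x -> 0 <= (u ^ 2 - 1) * (psi u * Derive psi u)).
  { intros u Hu.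
    replace 0 with ((1 ^ 2 - 1) * (psi 1 * Derive psi 1)) by ring.
    apply (nondecreasing_of_derive_nonneg
             (fun u => (u ^ 2 - 1) * (psi u * Derive psi u))
             (fun u => (u ^ 2 - 1) * Derive psi u ^ 2
                       + (chi - c ^ 2 * u ^ 2) * psi u ^ 2)); [lra | |].
    - intros t Ht. destruct (Hode t) as [D1 [D2 D3]].
      auto_derive; [repeat split; auto|].
      change (fun x => psi x) with psi. change (fun x => Derive psi x) with (Derive psi).
      apply Rminus_diag_uniq.
      transitivity (- psi t * ((1 - t ^ 2) * Derive (Derive psi) t - 2 * t * Derive psi t
         + (chi - c ^ 2 * t ^ 2) * psi t)); [ring | rewrite D3; ring].
    - intros t Ht. apply Rplus_le_le_0_compat; apply Rmult_le_pos; try nra.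
      apply Hq; lra. }
  assert (Hmono : psi 1 ^ 2 <= psi x ^ 2).
  { apply (nondecreasing_of_derive_nonneg (fun u => psi u ^ 2)
             (fun u => 2 * (psi u * Derive psi u))); [lra | |].
    - intros t Ht. destruct (Hode t) as [D1 _].
      auto_derive; [auto|]. change (fun x => psi x) with psi. ring.
    - intros t Ht.
      (* At [t = 1] the factor [t^2 - 1] in [HH] vanishes and hides the sign; the equation itself
         gives [2 psi'(1) = (chi - c^2) psi(1)]. *)
      destruct (Req_dec t 1) as [-> | Hne].
      + destruct (Hode 1) as [_ [_ D3]].
        replace (Derive psi 1) with ((chi - c ^ 2) * psi 1 / 2) by lra.
        specialize (Hq 1). assert (0 <= chi - c ^ 2 * 1 ^ 2) by (apply Hq; lra).
        nra.
      + specialize (HH t Ht). assert (0 < t ^ 2 - 1) by nra. nra. }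
  intros H0. rewrite H0 in Hmono. nra.
Qed.

(** * Liouville transform and its energy beyond the turning point *)

(* With [w = ((x^2 - 1)(x^2 - b))^(1/4)], [b = chi / c^2], and the phase
   variable [S], [dS = c sqrt ((x^2 - b)/(x^2 - 1)) dx], the function
   [u = w psi] satisfies [u_SS + (1 + V / c^2) u = 0]; this is [V]. *)
Definition liouville_potential (b x : R) : R :=
  ((6 * b - 2) * (x ^ 2 - 1) - (b - 1) ^ 2 + (b - 1) ^ 2 / (x ^ 2 - 1))
    / (4 * (x ^ 2 - b) ^ 3).

(** The energy divided by [w^2]: expanding [u_S] with [w'/w = x (2 x^2 - 1 - b) / (2 (x^2 - 1) (x^2
    - b))] leaves rational coefficients only. *)
Definition liouville_form (c b : R) (psi : R -> R) (x : R) : R :=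
  (x ^ 2 - 1) / (x ^ 2 - b) * Derive psi x ^ 2
  + x * (2 * x ^ 2 - 1 - b) / (x ^ 2 - b) ^ 2 * (psi x * Derive psi x)
  + (c ^ 2 + x ^ 2 * (2 * x ^ 2 - 1 - b) ^ 2
               / (4 * (x ^ 2 - 1) * (x ^ 2 - b) ^ 3)
     + liouville_potential b x) * psi x ^ 2.

(* This is [c^2 (u_S^2 + (1 + V / c^2) u^2)]. *)
Definition liouville_energy (c b : R) (psi : R -> R) (x : R) : R :=
  sqrt ((x ^ 2 - 1) * (x ^ 2 - b)) * liouville_form c b psi x.

Definition liouville_potential_slope (b x : R) : R :=
  2 * x * (((6 * b - 2) - (b - 1) ^ 2 / (x ^ 2 - 1) ^ 2) * (x ^ 2 - b)
     - 3 * ((6 * b - 2) * (x ^ 2 - 1) - (b - 1) ^ 2 + (b - 1) ^ 2 / (x ^ 2 - 1)))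
    / (4 * (x ^ 2 - b) ^ 4).

(** Since [x^2 - 1 > b - 1 > 0], the linear term of the numerator exceeds [(6 b - 2) (b - 1)], which
    is larger than [(b - 1)^2]. *)
Lemma liouville_potential_nonneg (b x : R) :
  1 < b -> b < x ^ 2 -> 0 <= liouville_potential b x.
Proof.
  intros Hb Hx. unfold liouville_potential.
  set (y := x ^ 2) in *.
  assert (0 < (y - b) ^ 3) by (apply pow_lt; lra).
  assert (0 < / (y - 1)) by (apply Rinv_0_lt_compat; lra).
  apply Rmult_le_pos; [| left; apply Rinv_0_lt_compat; lra].
  assert (0 <= (b - 1) ^ 2 / (y - 1)) by (apply Rmult_le_pos; [nra | lra]).
  nra.
Qed.

(** With [y = x^2], the bound [y - b < y - 1] leaves at most [- 2 (6 b - 2) (y - 1) + 3 (b - 1)^2],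
    negative because [y - 1 > b - 1]; the terms with [P] and [Q] only lower it. *)
Lemma liouville_potential_slope_nonpos (b x : R) :
  1 < b -> 0 < x -> b < x ^ 2 -> liouville_potential_slope b x <= 0.
Proof.
  intros Hb H0 Hx. unfold liouville_potential_slope.
  set (y := x ^ 2) in *.
  assert (0 < (y - b) ^ 4) by (apply pow_lt; lra).
  assert (Hi : 0 < / (4 * (y - b) ^ 4)) by (apply Rinv_0_lt_compat; lra).
  assert (0 < / (y - 1)) by (apply Rinv_0_lt_compat; lra).
  assert (0 < / (y - 1) ^ 2) by (apply Rinv_0_lt_compat, pow_lt; lra).
  assert (P1 : 0 <= (b - 1) ^ 2 / (y - 1)) by (apply Rmult_le_pos; [nra | lra]).
  assert (P2 : 0 <= (b - 1) ^ 2 / (y - 1) ^ 2) by (apply Rmult_le_pos; [nra | lra]).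
  unfold Rdiv at 1.
  set (P := (b - 1) ^ 2 / (y - 1)) in *.
  set (Q := (b - 1) ^ 2 / (y - 1) ^ 2) in *.
  assert (0 <= Q * (y - b)) by (apply Rmult_le_pos; lra).
  assert (((6 * b - 2) - Q) * (y - b)
     - 3 * ((6 * b - 2) * (y - 1) - (b - 1) ^ 2 + P) <= 0) by nra.
  set (Z := _ - 3 * _) in *.
  assert (2 * x * Z <= 0) by nra.
  nra.
Qed.

(** For [u_SS + (1 + V / c^2) u = 0] the energy changes only through the derivative of [V], here
    multiplied by [u^2 = w^2 psi^2]. *)
Lemma liouville_energy_is_derive (c b : R) (psi : R -> R) (x : R) :
  0 < c -> prolate_ode c (c ^ 2 * b) psi -> 1 < b -> b < x ^ 2 ->
  is_derive (liouville_energy c b psi) x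
    (sqrt ((x ^ 2 - 1) * (x ^ 2 - b))
     * (liouville_potential_slope b x * psi x ^ 2)).
Proof.
  intros Hc Hode Hb Hx.
  destruct (Hode x) as [H1 [H2 H3]].
  set (f := (x ^ 2 - 1) * (x ^ 2 - b)).
  assert (Hf : 0 < f) by (unfold f; nra).
  assert (HS : is_derive (fun x => sqrt ((x ^ 2 - 1) * (x ^ 2 - b))) x
     (sqrt f * (2 * x * (2 * x ^ 2 - 1 - b) / (2 * f)))).
  { auto_derive; [unfold f in Hf; simpl in Hf; tauto|].
    change (x * (x * 1)) with (x ^ 2).
    replace ((x ^ 2 + - (1)) * (x ^ 2 + - b)) with f by (unfold f; ring).
    assert (Hs := sqrt_lt_R0 f Hf).
    replace (2 * f) with (2 * (sqrt f * sqrt f)) by (rewrite sqrt_sqrt; lra).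
    field. lra. }
  (* The subtracted term cancels the logarithmic derivative of the square root factor in the product
     rule. *)
  assert (HD : is_derive (liouville_form c b psi) x
     (liouville_potential_slope b x * psi x ^ 2
      - 2 * x * (2 * x ^ 2 - 1 - b) / (2 * f) * liouville_form c b psi x)).
  { unfold liouville_form, liouville_potential, liouville_potential_slope, f.
    auto_derive.
    - assert (0 < (x ^ 2 - b) ^ 3) by (apply pow_lt; lra).
      repeat split; auto; try (simpl in *; nra); try (apply Rgt_not_eq; simpl in *; nra).
    - change (fun x => psi x) with psi. change (fun x => Derive psi x) with (Derive psi).
      replace (Derive (Derive psi) x) with
        ((- 2 * x * Derive psi x - c ^ 2 * (x ^ 2 - b) * psi x) / (x ^ 2 - 1)).
      2: { apply (Rmult_eq_reg_l (x ^ 2 - 1)); [|lra].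
           replace ((x ^ 2 - 1) * (_ / _)) with
             (- 2 * x * Derive psi x - c ^ 2 * (x ^ 2 - b) * psi x) by (field; lra).
           lra. }
      field. simpl in *. split; lra. }
  apply is_derive_ext with (f :=
    fun x => sqrt ((x ^ 2 - 1) * (x ^ 2 - b)) * liouville_form c b psi x);
    [reflexivity|].
  evar_last.
  - apply (is_derive_mult (fun x => sqrt ((x ^ 2 - 1) * (x ^ 2 - b)))
      (liouville_form c b psi)); [exact HS | exact HD | intros; apply Rmult_comm].
  - unfold plus, mult; simpl. fold f.
    change (x * (x * 1)) with (x ^ 2). fold f.
    ring.
Qed.

Lemma liouville_energy_lower_bound (c b : R) (psi : R -> R) (x : R) :
  1 < b -> b < x ^ 2 ->
  c ^ 2 * sqrt ((x ^ 2 - 1) * (x ^ 2 - b)) * psi x ^ 2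
    <= liouville_energy c b psi x.
Proof.
  intros Hb Hx. unfold liouville_energy.
  rewrite (Rmult_comm (c ^ 2)), Rmult_assoc.
  apply Rmult_le_compat_l; [apply sqrt_pos|].
  assert (HT := liouville_potential_nonneg b x Hb Hx).
  unfold liouville_form.
  set (T := liouville_potential b x) in *.
  set (v := Derive psi x). set (u := psi x).
  assert (0 <= T * u ^ 2) by (apply Rmult_le_pos; nra).
  (* This completed square is [c^2 (u_S / w)^2]; it and the [V] term are what the lower bound
     discards. *)
  assert (0 <= (x ^ 2 - 1) / (x ^ 2 - b)
     * (v + x * (2 * x ^ 2 - 1 - b) / (2 * (x ^ 2 - 1) * (x ^ 2 - b)) * u) ^ 2).
  { apply Rmult_le_pos; [| apply pow2_ge_0].
    apply Rmult_le_pos; [lra | left; apply Rinv_0_lt_compat; lra]. }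
  apply Rminus_le.
  match goal with |- ?lhs <= 0 => replace lhs with (- (T * u ^ 2) - (x ^ 2 - 1) / (x ^ 2 - b)
     * (v + x * (2 * x ^ 2 - 1 - b) / (2 * (x ^ 2 - 1) * (x ^ 2 - b)) * u) ^ 2)
     by (field; lra) end.
  lra.
Qed.

Lemma liouville_energy_nonincreasing (c b : R) (psi : R -> R) (x y : R) :
  0 < c -> prolate_ode c (c ^ 2 * b) psi -> 1 < b -> 0 < x -> b < x ^ 2 -> x <= y ->
  liouville_energy c b psi y <= liouville_energy c b psi x.
Proof.
  intros Hc Hode Hb H0 Hx Hxy.
  enough (- liouville_energy c b psi x <= - liouville_energy c b psi y) by lra.
  apply (nondecreasing_of_derive_nonneg (fun t => - liouville_energy c b psi t)
    (fun t => - (sqrt ((t ^ 2 - 1) * (t ^ 2 - b))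
     * (liouville_potential_slope b t * psi t ^ 2)))); [lra | |].
  - intros t Ht. apply (is_derive_opp (liouville_energy c b psi)).
    apply liouville_energy_is_derive; auto. nra.
  - intros t Ht.
    assert (liouville_potential_slope b t <= 0)
      by (apply liouville_potential_slope_nonpos; nra).
    pose proof (sqrt_pos ((t ^ 2 - 1) * (t ^ 2 - b))).
    assert (0 <= - liouville_potential_slope b t * psi t ^ 2)
      by (apply Rmult_le_pos; nra).
    nra.
Qed.

(** * Parity, normalization, and reduction to a real transform *)

(** The cosine integral is even in [x] and the sine integral odd, so whichever part of [lam] is
    nonzero forces the parity of [psi]. *)
Lemma Fc_eigen_parity (c : R) (lam : C) (psi : R -> R) :
  lam <> 0%C -> Fc_eigen c lam psi ->
  (Re lam <> 0 /\ forall x, psi (- x) = psi x)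
  \/ (Re lam = 0 /\ Im lam <> 0 /\ forall x, psi (- x) = - psi x).
Proof.
  intros Hlam Heig.
  destruct (Req_dec (Re lam) 0) as [H0 | H0].
  - right.
    assert (Him : Im lam <> 0).
    { intros H1. apply Hlam. destruct lam as [a b]. simpl in *. now subst. }
    repeat split; auto. intros x.
    apply (Rmult_eq_reg_l (Im lam)); [|exact Him].
    destruct (Heig x) as [_ [Ex [_ E1]]]. destruct (Heig (- x)) as [_ [_ [_ E2]]].
    rewrite E2. replace (Im lam * - psi x) with (- (Im lam * psi x)) by ring.
    rewrite E1.
    rewrite <- (RInt_opp (V := R_CompleteNormedModule)
      (fun t => psi t * sin (c * x * t))) by exact Ex.
    apply RInt_ext. intros t _.
    change (psi t * sin (c * - x * t) = - (psi t * sin (c * x * t))).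
    replace (c * - x * t) with (- (c * x * t)) by ring. rewrite sin_neg. ring.
  - left. split; auto. intros x.
    apply (Rmult_eq_reg_l (Re lam)); [|exact H0].
    destruct (Heig x) as [_ [_ [E1 _]]]. destruct (Heig (- x)) as [_ [_ [E2 _]]].
    rewrite E2, E1.
    apply RInt_ext. intros t _.
    replace (c * - x * t) with (- (c * x * t)) by ring. now rewrite cos_neg.
Qed.

Lemma pswf_endpoint_bound (c chi : R) (lam : C) (psi : R -> R) :
  lam <> 0%C -> Fc_eigen c lam psi -> prolate_ode c chi psi -> c ^ 2 < chi ->
  ex_RInt (fun t => psi t ^ 2) (-1) 1 -> RInt (fun t => psi t ^ 2) (-1) 1 = 1 ->
  1 / 2 <= psi 1 ^ 2.
Proof.
  intros Hlam Heig Hode Hchi Hex Hnorm.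
  assert (Hpar : psi (-1) ^ 2 = psi 1 ^ 2).
  { destruct (Fc_eigen_parity c lam psi Hlam Heig) as [[_ H] | [_ [_ H]]];
      replace (-1) with (- (1)) by ring; rewrite H; ring. }
  assert (H : RInt (fun t => psi t ^ 2) (-1) 1
              <= RInt (fun _ => psi 1 ^ 2) (-1) 1).
  { apply RInt_le; [lra | exact Hex | apply ex_RInt_const |].
    intros t Ht. apply (prolate_endpoint_max c chi psi); auto; lra. }
  rewrite RInt_const, Hnorm in H. unfold scal in H; simpl in H.
  unfold mult in H; simpl in H. lra.
Qed.

(** Parity makes [lam] real or purely imaginary, so a real multiplier [m] of the same modulus
    replaces it. The last clause makes the two boundary terms of the asymptotics add up instead of
    cancelling. *)
Lemma Fc_eigen_cos_transform (c : R) (lam : C) (psi : R -> R) :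
  lam <> 0%C -> Fc_eigen c lam psi -> psi 1 <> 0 ->
  exists m p, m <> 0 /\ Cmod lam = Rabs m /\
    (forall x, m * psi x = cos_transform c p psi x) /\
    (forall w, psi (-1) * sin (- w + p) = - (psi 1 * sin (w + p))).
Proof.
  intros Hlam Heig H1.
  unfold cos_transform.
  destruct (Fc_eigen_parity c lam psi Hlam Heig) as [[Hre H] | [Hre [Him H]]].
  (* [Im lam * psi] is odd by its sine integral and even because [psi] is, while [psi 1] is
     nonzero. *)
  - assert (Him : Im lam = 0).
    { destruct (Heig 1) as [_ [Ex [_ E1]]]. destruct (Heig (- (1))) as [_ [_ [_ E2]]].
      assert (E3 : Im lam * psi (- (1)) = - (Im lam * psi 1)).
      { rewrite E2, E1.
        rewrite <- (RInt_opp (V := R_CompleteNormedModule)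
          (fun t => psi t * sin (c * 1 * t))) by exact Ex.
        apply RInt_ext. intros t _.
        change (psi t * sin (c * - (1) * t) = - (psi t * sin (c * 1 * t))).
        replace (c * - (1) * t) with (- (c * 1 * t)) by ring. rewrite sin_neg. ring. }
      rewrite H in E3. apply (Rmult_eq_reg_r (psi 1)); [lra | exact H1]. }
    exists (Re lam), 0. repeat split; auto.
    + unfold Cmod. change (fst lam) with (Re lam). change (snd lam) with (Im lam).
      rewrite Him. replace (Re lam ^ 2 + 0 ^ 2) with (Rsqr (Re lam)) by (unfold Rsqr; ring).
      apply sqrt_Rsqr_abs.
    + intros x. destruct (Heig x) as [_ [_ [E1 _]]]. rewrite E1.
      apply RInt_ext. intros t _. now rewrite Rplus_0_r.
    + intros w. replace (-1) with (- (1)) by ring.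
      rewrite H, !Rplus_0_r, sin_neg. ring.
  - exists (Im lam), (- (PI / 2)). repeat split; auto.
    + unfold Cmod. change (fst lam) with (Re lam). change (snd lam) with (Im lam).
      rewrite Hre. replace (0 ^ 2 + Im lam ^ 2) with (Rsqr (Im lam)) by (unfold Rsqr; ring).
      apply sqrt_Rsqr_abs.
    + intros x. destruct (Heig x) as [_ [_ [_ E1]]]. rewrite E1.
      apply RInt_ext. intros t _. f_equal.
      rewrite <- cos_shift, <- cos_neg. f_equal. ring.
    + intros w. replace (-1) with (- (1)) by ring. rewrite H.
      replace (- w + - (PI / 2)) with (- (w + PI / 2)) by ring.
      replace (w + - (PI / 2)) with (- (PI / 2 - w)) by ring.
      rewrite !sin_neg, sin_shift, Rplus_comm, <- cos_sin. ring.
Qed.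

(** * Energy bound from infinity and the estimate at a root *)

Lemma sin_phase_eq_1_unbounded (c p B : R) :
  0 < c -> exists X, B <= X /\ 0 < X /\ sin (c * X + p) = 1.
Proof.
  intros Hc.
  destruct (INR_unbounded (Rmax (c * B) 1 + Rabs p)) as [k Hk].
  pose proof PI2_1 as HPI.
  pose proof (Rle_abs p). pose proof (Rmax_l (c * B) 1). pose proof (Rmax_r (c * B) 1).
  pose proof (pos_INR k). pose proof (Rabs_pos p).
  assert (HX : Rmax (c * B) 1 <= PI / 2 + 2 * INR k * PI - p) by nra.
  exists ((PI / 2 + 2 * INR k * PI - p) / c). repeat split.
  - apply (Rmult_le_reg_l c); [lra|].
    replace (c * (_ / c)) with (PI / 2 + 2 * INR k * PI - p) by (field; lra). lra.
  - apply Rdiv_lt_0_compat; lra.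
  - replace (c * (_ / c) + p) with (PI / 2 + 2 * INR k * PI) by (field; lra).
    rewrite sin_period. apply sin_PI2.
Qed.

Lemma pswf_energy_lower_bound (c b m p : R) (psi : R -> R) (x : R) :
  0 < c -> 1 < b -> 0 < x -> b < x ^ 2 ->
  prolate_ode c (c ^ 2 * b) psi -> m <> 0 -> 1 / 2 <= psi 1 ^ 2 ->
  (forall x, m * psi x = cos_transform c p psi x) ->
  (forall w, psi (-1) * sin (- w + p) = - (psi 1 * sin (w + p))) ->
  1 <= m ^ 2 * liouville_energy c b psi x.
Proof.
  intros Hc Hb Hx0 Hx Hode Hm H1 Heig Hpar.
  assert (D1 : forall t, ex_derive psi t) by (intros t; apply (Hode t)).
  assert (D2 : forall t, ex_derive (Derive psi) t) by (intros t; apply (Hode t)).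
  assert (Hcont : forall t, continuous psi t)
    by (intros t; now apply (ex_derive_continuous psi)).
  destruct (cos_integral_asymptotics psi p D1 D2) as [K HK].
  { now apply (continuous_Derive2_eigenfunction c m p). }
  (* The term [x + 2 * b] gives [X >= x] and [X^2 >= 4 b], so both factors under the root are at
     least [3/4 X^2]; the term [5 * Rabs K / c] brings the asymptotic error down to 1/5. *)
  destruct (sin_phase_eq_1_unbounded c p (Rmax (x + 2 * b) (5 * Rabs K / c)) Hc)
    as [X [HX1 [HX2 HX3]]].
  pose proof (Rmax_l (x + 2 * b) (5 * Rabs K / c)).
  pose proof (Rmax_r (x + 2 * b) (5 * Rabs K / c)).
  assert (Hmono : liouville_energy c b psi X <= liouville_energy c b psi x)
    by (apply liouville_energy_nonincreasing; auto; lra).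
  assert (HbX : 4 * b <= X ^ 2) by nra.
  assert (Hlow : c ^ 2 * sqrt ((X ^ 2 - 1) * (X ^ 2 - b)) * psi X ^ 2
    <= liouville_energy c b psi X) by (apply liouville_energy_lower_bound; lra).
  assert (Hsq : 3 / 4 * X ^ 2 <= sqrt ((X ^ 2 - 1) * (X ^ 2 - b))).
  { rewrite <- (sqrt_pow2 (3 / 4 * X ^ 2)) by nra.
    apply sqrt_le_1_alt. simpl (_ ^ 2 * _). nra. }
  set (w := c * X) in *.
  assert (Hw : 0 < w) by (unfold w; nra).
  assert (HKw : Rabs K / w <= 1 / 5).
  { apply (Rmult_le_reg_r w); [lra|].
    replace (Rabs K / w * w) with (Rabs K) by (field; lra).
    assert (5 * Rabs K / c * c <= X * c) by (apply Rmult_le_compat_r; lra).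
    replace (5 * Rabs K / c * c) with (5 * Rabs K) in * by (field; lra).
    unfold w. lra. }
  assert (Hasym : Rabs (w * (m * psi X) - 2 * psi 1) <= 1 / 5).
  { specialize (HK w Hw). rewrite Hpar, HX3 in HK.
    change (RInt (fun t => psi t * cos (w * t + p)) (-1) 1)
      with (cos_transform c p psi X) in HK. rewrite <- Heig in HK.
    replace (w * (m * psi X) - 2 * psi 1)
      with (w * (m * psi X - (psi 1 * 1 - - (psi 1 * 1)) / w)) by (field; lra).
    rewrite Rabs_mult, (Rabs_pos_eq w) by lra.
    apply Rle_trans with (w * (K / w ^ 2)); [apply Rmult_le_compat_l; lra|].
    replace (w * (K / w ^ 2)) with (K / w) by (field; lra).
    apply Rle_trans with (Rabs K / w); [|exact HKw].
    apply Rmult_le_compat_r; [left; now apply Rinv_0_lt_compat | apply Rle_abs]. }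
  (* From [psi(1)^2 >= 1/2] one gets [|psi(1)| >= 7/10], so the modulus is at least
     [7/5 - 1/5 = 6/5]. The factor 3/4 then leaves [27/25 >= 1]. *)
  assert (Hbig : 36 / 25 <= (w * (m * psi X)) ^ 2).
  { apply Rabs_le_between in Hasym.
    set (z := w * (m * psi X)) in *.
    destruct (Rle_dec 0 (psi 1)).
    - assert (7 / 10 <= psi 1) by nra. nra.
    - assert (psi 1 <= - (7 / 10)) by nra. nra. }
  apply Rle_trans with (m ^ 2 * (c ^ 2 * (3 / 4 * X ^ 2) * psi X ^ 2)).
  - replace (m ^ 2 * _) with (3 / 4 * (w * (m * psi X)) ^ 2) by (unfold w; ring).
    lra.
  - apply Rmult_le_compat_l; [nra|].
    apply Rle_trans with (2 := Hmono). apply Rle_trans with (2 := Hlow).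
    apply Rmult_le_compat_r; [nra|]. apply Rmult_le_compat_l; [nra | exact Hsq].
Qed.

Theorem theorem43 (c : R) (lam : nat -> C) (psi : nat -> R -> R)
  (chi : nat -> R) (n : nat) (x : R) :
  0 < c ->
  pswf_family c lam psi chi ->
  c ^ 2 < chi n ->
  1 < x ->
  psi n x = 0 ->
  / Rabs (Derive (psi n) x)
    <= exp (1 / 4) * Cmod (lam n)
       * Rpower (x ^ 2 - 1) (3 / 4) / Rpower (x ^ 2 - chi n / c ^ 2) (1 / 4).
Proof.
  intros Hc [Hlam [_ [Heig [Hnorm [_ [_ Hode]]]]]] Hchi Hx Hroot.
  specialize (Hlam n). specialize (Heig n). specialize (Hode n).
  destruct (Hnorm n) as [Hex Hint]. clear Hnorm.
  assert (H1 : 1 / 2 <= psi n 1 ^ 2)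
    by (now apply (pswf_endpoint_bound c (chi n) (lam n))).
  assert (Hne : psi n 1 <> 0) by (intros H; rewrite H in H1; lra).
  assert (Hc2 : 0 < c ^ 2) by nra.
  set (b := chi n / c ^ 2).
  assert (Hbc : c ^ 2 * b = chi n) by (unfold b; field; lra).
  assert (Hb : 1 < b) by nra.
  assert (Hxb : b < x ^ 2).
  { apply Rnot_le_lt. intros H.
    apply (prolate_no_root_before_turning_point c (chi n) (psi n) x Hode Hne);
      [lra | nra | exact Hroot]. }
  destruct (Fc_eigen_cos_transform c (lam n) (psi n) Hlam Heig Hne)
    as [m [p [Hm [Hmod [Htr Hpar]]]]].
  rewrite <- Hbc in Hode.
  assert (HE : 1 <= m ^ 2 * liouville_energy c b (psi n) x)
    by (apply (pswf_energy_lower_bound c b m p (psi n) x); auto; lra).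
  unfold liouville_energy, liouville_form in HE. rewrite Hroot in HE.
  rewrite Hmod.
  set (d := Derive (psi n) x) in *.
  set (s := x ^ 2 - 1) in *. set (r := x ^ 2 - b) in *.
  assert (Hs : 0 < s) by (unfold s; nra).
  assert (Hr : 0 < r) by (unfold r; lra).
  (* Fourth roots turn all the real powers into integer powers; the energy coefficient
     [sqrt (s r) * s / r] becomes [(S^3 / Q)^2]. *)
  set (S := Rpower s (1 / 4)). set (Q := Rpower r (1 / 4)).
  assert (HS : 0 < S) by apply exp_pos.
  assert (HQ : 0 < Q) by apply exp_pos.
  assert (HS4 : s = S ^ 4).
  { unfold S. rewrite <- Rpower_pow, Rpower_mult by apply exp_pos.
    replace (1 / 4 * INR 4) with 1 by (simpl; field). now rewrite Rpower_1. }
  assert (HQ4 : r = Q ^ 4).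
  { unfold Q. rewrite <- Rpower_pow, Rpower_mult by apply exp_pos.
    replace (1 / 4 * INR 4) with 1 by (simpl; field). now rewrite Rpower_1. }
  assert (HS3 : Rpower s (3 / 4) = S ^ 3).
  { unfold S. rewrite <- Rpower_pow, Rpower_mult by apply exp_pos.
    f_equal. simpl. field. }
  assert (Hsqrt : sqrt (s * r) = S ^ 2 * Q ^ 2).
  { rewrite HS4, HQ4. replace (S ^ 4 * Q ^ 4) with ((S ^ 2 * Q ^ 2) ^ 2) by ring.
    apply sqrt_pow2. nra. }
  rewrite HS3. rewrite Hsqrt in HE.
  assert (HE' : 1 <= (Rabs m * Rabs d * S ^ 3 / Q) ^ 2).
  { replace ((Rabs m * Rabs d * S ^ 3 / Q) ^ 2)
      with (Rabs m ^ 2 * Rabs d ^ 2 * (S ^ 3 / Q) ^ 2) by (field; lra).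
    rewrite !pow2_abs. eapply Rle_trans; [exact HE|]. right.
    rewrite HS4, HQ4. field. lra. }
  assert (HP : 0 < S ^ 3 / Q) by (apply Rdiv_lt_0_compat; [apply pow_lt|]; lra).
  assert (Hm0 := Rabs_pos_lt m Hm).
  assert (HE1 : 1 <= Rabs m * Rabs d * S ^ 3 / Q).
  { apply Rnot_lt_le. intros Hlt. pose proof (Rabs_pos d).
    assert (0 <= Rabs m * Rabs d * S ^ 3 / Q).
    { unfold Rdiv. rewrite Rmult_assoc. apply Rmult_le_pos; [nra|]. unfold Rdiv in HP; lra. }
    nra. }
  (* The root is simple: [d = 0] would make the energy there vanish. *)
  assert (Hd : 0 < Rabs d).
  { destruct (Req_dec d 0) as [H0 | H0]; [|now apply Rabs_pos_lt].
    rewrite H0, Rabs_R0 in HE1. unfold Rdiv in HE1. lra. }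
  (* [HE1] is the estimate with constant 1, and [exp (1 / 4)] only enlarges the right side. *)
  assert (He : 1 <= exp (1 / 4)) by (pose proof (exp_ineq1_le (1 / 4)); lra).
  apply (Rmult_le_reg_l (Rabs d)); [exact Hd|].
  rewrite Rinv_r by lra.
  replace (Rabs d * _) with (exp (1 / 4) * (Rabs m * Rabs d * S ^ 3 / Q)) by (field; lra).
  nra.
Qed.
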